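(* Let $p\in(0,1)$ and $C\in\mathbb{N}$ with $C\ge4$ be constants and let $k=k_0-C$, where $k_0=k_0(n,p)$ is the least integer with $\binom{n}{k_0}p^{\binom{k_0}{2}}<1$. Then, except with probability at most $\exp(-n^{1+o(1)})$, the random graph $G(n,p)$ does not contain any family of \[\frac{5(C-2)}{1-p}\cdot\frac{pn^2\log n}{k^4}\] pairwise edge-disjoint $k$-cliques.
   Context: $G(n,p)$ is the Erdős–Rényi random graph on $\{1,\dots,n\}$; $\log$ is the natural logarithm; $o(1)$ denotes a quantity tending to $0$ as $n\to\infty$. *)

(* Defs.v *)
From mathcomp Require Export all_boot all_order all_algebra.
From mathcomp Require Export all_classical all_reals all_analysis.

Set Implicit Arguments.
Unset Strict Implicit.
Unset Printing Implicit Defensive.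

Export Order.TTheory GRing.Theory Num.Theory.
Export numFieldNormedType.Exports.

Local Open Scope ring_scope.

Definition pairs n : {set {set 'I_n}} := [set e : {set 'I_n} | #|e| == 2].

(* A simple graph on 'I_n is given by its edge set. *)
Definition graph n := {G : {set {set 'I_n}} | G \subset pairs n}.

(* Probability that G(n, p), in which the pairs are edges independently of each
   other with probability p, has the property A. *)
Definition Gnp_prob (R : realType) (p : R) n (A : pred (graph n)) : R :=
  \sum_(G : graph n | A G)
     \prod_(e in pairs n) (if e \in val G then p else 1 - p).

Definition edges_in n (K : {set 'I_n}) : {set {set 'I_n}} :=
  [set e in pairs n | e \subset K].

Definition is_clique n (G : graph n) k (K : {set 'I_n}) : bool :=
  (#|K| == k) && (edges_in K \subset val G).

Definition edge_disjoint_cliques n (G : graph n) k (F : {set {set 'I_n}}) : bool :=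
  [forall K in F, is_clique G k K] &&
  [forall K in F, forall L in F,
     (K != L) ==> [disjoint edges_in K & edges_in L]].

(* For real m, a family of m cliques is one with at least m members. *)
Definition has_edge_disjoint_cliques (R : realType) n k (m : R) (G : graph n) : bool :=
  [exists F : {set {set 'I_n}},
     edge_disjoint_cliques G k F && (m <= #|F|%:R)].

Definition few_cliques (R : realType) (p : R) n k : bool :=
  'C(n, k)%:R * p ^+ 'C(k, 2) < 1.

Lemma few_cliques_ex (R : realType) (p : R) n : exists k, few_cliques p n k.
Proof. by exists n.+1; rewrite /few_cliques bin_small// mul0r ltr01. Qed.

Definition k0 (R : realType) (p : R) n : nat := ex_minn (few_cliques_ex p n).

(* Main.v *)
(** Write q = 1 - p, N = 'C(n, 2), K = 'C(k, 2) and let r be the least integer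
    not below the prescribed number of cliques.  A family of r edge-disjoint
    k-cliques forces r K given pairs to be edges.  Up to a negligible
    probability the graph has at most p N + t edges, where t = n^2 / k^3, and
    under this restriction a Chernoff bound shows that the given pairs are
    edges with probability about p^(r K) exp(- q (r K)^2 / (2 p N)) instead of
    p^(r K).  There are at most (e 'C(n, k) / r)^r families, and
    'C(n, k) p^K / r <= n^(C - 2 + o(1)) because passing from k to k + 1 divides
    the expected number of k-cliques by at most n^(1 + o(1)).  The constant 5
    (anything above 4 would do) makes the gain n^(- (5/4) (C - 2) r) beat the
    union bound n^((C - 2) r). *)

Require Import Defs.
From mathcomp Require Import fintype finset ring lra zify.

Set Implicit Arguments.
Unset Strict Implicit.
Unset Printing Implicit Defensive.

Local Open Scope ring_scope.

(** * Exponential moments of the number of edges *)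

Lemma graph_sum (R : realType) n (f : {set {set 'I_n}} -> R) :
  \sum_(G : graph n) f (val G) = \sum_(H : {set {set 'I_n}} | H \subset pairs n) f H.
Proof.
rewrite (reindex_omap (op:=+%R) (val : graph n -> _) insub) /=; last first.
  by move=> H sH; rewrite insubT.
apply: eq_bigl => G; rewrite (valP G) /= valK eqxx //.
Qed.

(* The weights vanish on graphs that do not contain S. *)
Lemma sum_subsets_containing (R : realType) (T : finType) (P S : {set T}) (x y : R) :
  S \subset P ->
  \sum_(H : {set T} | H \subset P)
     \prod_(e in P) (if e \in H then x else if e \in S then 0 else y) =
  x ^+ #|S| * (y + x) ^+ (#|P| - #|S|).
Proof.
move=> sSP.
(* The sum over subsets is the expansion of the product of all [F e + G e]. Since [F] is 0 outside
   [P], only subsets of [P] survive, and [G] is 1 there, so elements outside [P] contribute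
   nothing. *)
pose F e : R := if e \in P then x else 0.
pose G e : R := if e \in P then if e \in S then 0 else y else 1.
have : \prod_e (F e + G e) =
    \sum_(J in {set T}) \prod_i (if i \in J then F i else G i) by exact: bigA_distr.
have -> : \sum_(J in {set T}) \prod_i (if i \in J then F i else G i) =
   \sum_(H : {set T} | H \subset P)
     \prod_(e in P) (if e \in H then x else if e \in S then 0 else y).
  rewrite big_mkcond [RHS]big_mkcond; apply: eq_bigr => H _ /=.
  case: ifPn => [sHP|/subsetPn[e eH eP]]; last first.
    by rewrite (bigD1 e) //= eH /F (negbTE eP) mul0r.
  rewrite [RHS]big_mkcond; apply: eq_bigr => e _.
  rewrite /F /G; case: ifPn => [eH|_]; last by case: ifP.
  by rewrite (subsetP sHP _ eH).
move=> <-; rewrite (bigID (mem P)) /= [X in _ * X]big1 ?mulr1; last first.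
  by move=> e /negbTE eP; rewrite /F /G eP add0r.
rewrite (bigID (mem S)) /= (eq_bigr (fun=> x)); last first.
  by move=> e /andP[eP eS]; rewrite /F /G eP eS addr0.
rewrite [X in _ * X](eq_bigr (fun=> y + x)); last first.
  by move=> e /andP[eP /negbTE eS]; rewrite /F /G eP eS addrC.
rewrite !prodr_const; congr (_ ^+ _ * _ ^+ _).
  by apply: eq_card => e; rewrite unfold_in; case eS: (e \in S); rewrite ?andbF // (subsetP sSP).
have -> : (#|P| - #|S| = #|P :\: S|)%N by rewrite cardsD (setIidPr sSP).
by apply: eq_card => e; rewrite unfold_in /= in_setD andbC.
Qed.

Definition Gnp_weight (R : realType) (p : R) n (H : {set {set 'I_n}}) : R :=
  \prod_(e in pairs n) (if e \in H then p else 1 - p).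

Lemma Gnp_weight_ge0 (R : realType) (p : R) n (H : {set {set 'I_n}}) :
  0 < p < 1 -> 0 <= Gnp_weight p H.
Proof.
by case/andP=> p0 p1; apply: prodr_ge0 => e _; case: ifP => _; lra.
Qed.

Lemma card_pairs n : #|pairs n| = 'C(n, 2).
Proof. by rewrite card_draws card_ord. Qed.

Lemma card_edges_in n (K : {set 'I_n}) : #|edges_in K| = 'C(#|K|, 2).
Proof.
by rewrite -cards_draws; apply: eq_card => e; rewrite !inE andbC.
Qed.

(** By independence, the expectation of [x ^+ #|G|] on the event that [G] contains [S] factorises: a
    pair in [S] contributes [p * x], any other pair [1 - p + p * x]. *)
Lemma Gnp_tilted_containing (R : realType) (p x : R) n (S : {set {set 'I_n}}) :
  S \subset pairs n ->
  \sum_(G : graph n) Gnp_weight p (val G) * x ^+ #|val G| *+ (S \subset val G) =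
  (p * x) ^+ #|S| * (1 - p + p * x) ^+ ('C(n, 2) - #|S|).
Proof.
move=> sS; rewrite -card_pairs -sum_subsets_containing //.
rewrite (graph_sum (fun H => Gnp_weight p H * x ^+ #|H| *+ (S \subset H))).
apply: eq_bigr => H sH; case: (boolP (S \subset H)) => [sSH|/subsetPn[e eS eH]].
  rewrite mulr1n; have -> : x ^+ #|H| = \prod_(e in pairs n) (if e \in H then x else 1).
    rewrite -big_mkcondr /= -prodr_const; apply: eq_bigl => e.
    by case eH: (e \in H); rewrite ?andbF // andbT (subsetP sH).
  rewrite -big_split /=; apply: eq_bigr => e _; case: ifPn => // eH.
  by rewrite mulr1 ifF //; apply: contraNF eH => /(subsetP sSH).
by rewrite mulr0n (bigD1 e) ?(subsetP sS) //= (negbTE eH) eS mul0r.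
Qed.

(** * Families of edge-disjoint cliques and the union bound *)

(** The part of [edge_disjoint_cliques] that does not depend on the graph, so that the union bound
    ranges over a fixed collection of families. *)
Definition linear_family n k (F : {set {set 'I_n}}) : bool :=
  [forall K in F, #|K| == k] &&
  [forall K in F, forall L in F,
     (K != L) ==> [disjoint edges_in K & edges_in L]].

Definition union_edges n (F : {set {set 'I_n}}) : {set {set 'I_n}} :=
  \bigcup_(K in F) edges_in K.

Lemma union_edges_sub n (F : {set {set 'I_n}}) : union_edges F \subset pairs n.
Proof.
by apply/bigcupsP => K _; apply/subsetP => e; rewrite inE => /andP[].
Qed.

Lemma card_union_edges n k (F : {set {set 'I_n}}) :
  linear_family k F -> #|union_edges F| = (#|F| * 'C(k, 2))%N.
Proof.
case/andP=> /forall_inP cF /forall_inP dF.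
(* Extending by [set0] outside [F] makes the sets pairwise disjoint over the whole index type. *)
pose E K := if K \in F then edges_in K else set0.
have -> : union_edges F = \bigcup_K E K by rewrite /union_edges big_mkcond.
rewrite -sum1_card partition_disjoint_bigcup => [|K L KL]; last first.
  rewrite /E; case: ifPn => KF; last by rewrite disjoints_subset sub0set.
  case: ifPn => LF; last by rewrite disjoint_sym disjoints_subset sub0set.
  exact: (implyP (forall_inP (dF K KF) L LF)).
rewrite -sum_nat_const [RHS]big_mkcond; apply: eq_bigr => K _.
rewrite sum1_card /E; case: ifPn => KF; last by rewrite cards0.
by rewrite card_edges_in (eqP (cF K KF)).
Qed.

(** Disjointness is simply forgotten: the family is an [r]-subset of the collection of all
    [k]-sets. *)
Lemma card_linear_families n k r :
  (#|[set F : {set {set 'I_n}} | linear_family k F & #|F| == r]| <= 'C('C(n, k), r))%N.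
Proof.
have <- : #|[set K : {set 'I_n} | #|K| == k]| = 'C(n, k) by rewrite card_draws card_ord.
rewrite -cards_draws; apply/subset_leq_card/subsetP => F; rewrite !inE.
case/andP=> /andP[/forall_inP cF _] ->; rewrite andbT.
by apply/subsetP => K KF; rewrite inE cF.
Qed.

Lemma linear_family_sub n k (F F' : {set {set 'I_n}}) :
  F' \subset F -> linear_family k F -> linear_family k F'.
Proof.
move=> /subsetP sF /andP[/forall_inP cF /forall_inP dF]; apply/andP; split.
  by apply/forall_inP => K /sF /cF.
apply/forall_inP => K /sF KF; apply/forall_inP => L /sF LF.
exact: (forall_inP (dF K KF) L LF).
Qed.

Lemma edge_disjoint_cliques_linear n (G : graph n) k (F : {set {set 'I_n}}) :
  edge_disjoint_cliques G k F -> linear_family k F /\ union_edges F \subset val G.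
Proof.
case/andP=> /forall_inP cF dF; split.
  by apply/andP; split=> //; apply/forall_inP => K /cF /andP[].
by apply/bigcupsP => K /cF /andP[].
Qed.

(* Markov's inequality for the exponential moments of the number of edges:
   either the graph has more than a edges, or it has at most a edges although
   it contains all edges of one of the families. *)
Lemma Gnp_prob_cliques_le (R : realType) (p th1 v th u a m : R) n k r :
  0 < p < 1 -> 0 <= th1 -> 0 <= th ->
  (forall j : nat, m <= j%:R -> (r <= j)%N) ->
  1 - p + p * expR th1 <= expR v ->
  1 - p + p * expR (- th) <= expR (- u) ->
  Gnp_prob p (@has_edge_disjoint_cliques R n k m) <=
  expR (v * 'C(n, 2)%:R - th1 * a) +
  'C('C(n, k), r)%:R * (p ^+ (r * 'C(k, 2)) *
    expR (th * a - th * (r * 'C(k, 2))%:R - u * ('C(n, 2)%:R - (r * 'C(k, 2))%:R))).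
Proof.
move=> hp th10 th0 hr hv hu; case/andP: (hp) => p0 p1.
pose w (G : graph n) := Gnp_weight p (val G).
pose Fam := [set F : {set {set 'I_n}} | linear_family k F & #|F| == r].
have w0 G : 0 <= w G by exact: Gnp_weight_ge0.
pose X (G : graph n) := expR (th1 * (#|val G|%:R - a)).
pose Y (G : graph n) := expR (th * (a - #|val G|%:R)).
have -> : Gnp_prob p (@has_edge_disjoint_cliques R n k m) =
    \sum_(G : graph n | has_edge_disjoint_cliques k m G) w G by [].
(* Pointwise domination: if [G] has at least [a] edges then [1 <= X G]; otherwise [1 <= Y G] and the
   union of some family in [Fam] lies in [G]. *)
have step1 : \sum_(G : graph n | has_edge_disjoint_cliques k m G) w G <=
    \sum_(G : graph n) (w G * X G +
       \sum_(F in Fam) w G * Y G *+ (union_edges F \subset val G)).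
  rewrite big_mkcond /=; apply: ler_sum => G _.
  have X0 : 0 <= w G * X G by rewrite mulr_ge0 // expR_ge0.
  have Y0 F : 0 <= w G * Y G *+ (union_edges F \subset val G).
    by rewrite mulrn_wge0 // mulr_ge0 // expR_ge0.
  have S0 : 0 <= \sum_(F in Fam) w G * Y G *+ (union_edges F \subset val G).
    by apply: sumr_ge0 => F _.
  case: ifP => [|_]; last exact: addr_ge0.
  case/existsP=> F /andP[/edge_disjoint_cliques_linear[lF uF] /hr rF].
  case: (lerP a #|val G|%:R) => aG.
    apply: (@le_trans _ _ (w G * X G)); rewrite ?lerDl // ler_peMr //.
    by rewrite -expR0 ler_expR mulr_ge0 // subr_ge0.
  (* The family is cut down to exactly [r] cliques, so that only one size enters the union bound. *)
  have [F' /andP[sF' cF']] : exists F' : {set {set 'I_n}}, (F' \subset F) && (#|F'| == r).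
    have : (0 < #|[set A : {set {set 'I_n}} | A \subset F & #|A| == r]|)%N.
      by rewrite cards_draws bin_gt0.
    by case/card_gt0P=> F'; rewrite inE => H; exists F'.
  have F'in : F' \in Fam by rewrite inE cF' (linear_family_sub sF').
  apply: (@le_trans _ _ (w G * Y G *+ (union_edges F' \subset val G))); last first.
    rewrite (bigD1 F') //= addrCA lerDl addr_ge0 //.
    by apply: sumr_ge0.
  have -> : union_edges F' \subset val G.
    apply: subset_trans uF; apply/bigcupsP => K KF'; apply: bigcup_sup.
    exact: (subsetP sF').
  rewrite mulr1n ler_peMr // -expR0 ler_expR mulr_ge0 // subr_ge0; exact: ltW.
apply: (le_trans step1); rewrite big_split /=; apply: lerD.
  have -> : \sum_(G : graph n) w G * X G =
      expR (- (th1 * a)) *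
      \sum_(G : graph n) Gnp_weight p (val G) * expR th1 ^+ #|val G| *+
          (set0 \subset val G).
    rewrite mulr_sumr; apply: eq_bigr => G _; rewrite sub0set mulr1n mulrCA.
    by rewrite /X -expRM_natr -expRD mulrBr addrC.
  rewrite Gnp_tilted_containing ?sub0set // cards0 expr0 mul1r subn0.
  rewrite [v * _ - _]addrC expRD ler_wpM2l ?expR_ge0 // expRM_natr lerXn2r // nnegrE ?expR_ge0 //.
  by rewrite addr_ge0 ?mulr_ge0 ?expR_ge0 //; lra.
(* After the exchange every family gets the same bound, because its union has exactly [s] edges. *)
rewrite exchange_big /=; set s := (r * 'C(k, 2))%N.
apply: (@le_trans _ _ (\sum_(F in Fam) (p ^+ s *
    expR (th * a - th * s%:R - u * ('C(n, 2)%:R - s%:R))))); last first.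
  rewrite sumr_const -[leLHS]mulr_natl ler_wpM2r ?mulr_ge0 ?expR_ge0 ?exprn_ge0 ?(ltW p0) //.
  by rewrite ler_nat card_linear_families.
apply: ler_sum => F; rewrite inE => /andP[lF /eqP cF].
have sE : #|union_edges F| = s by rewrite (card_union_edges lF) cF.
have sN : (s <= 'C(n, 2))%N by rewrite -sE -card_pairs subset_leq_card // union_edges_sub.
have -> : \sum_(G : graph n) w G * Y G *+ (union_edges F \subset val G) =
    expR (th * a) * \sum_(G : graph n) Gnp_weight p (val G) * expR (- th) ^+ #|val G| *+
          (union_edges F \subset val G).
  rewrite mulr_sumr; apply: eq_bigr => G _; case: (_ \subset _); rewrite ?mulr0n ?mulr0 //.
  by rewrite !mulr1n mulrCA /Y -expRM_natr -expRD mulrBr mulNr.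
rewrite Gnp_tilted_containing ?union_edges_sub // sE exprMn -expRM_natr.
rewrite -!mulrA [in leRHS](_ : th * a - _ - _ =
  th * a + (- th * s%:R + - u * ('C(n, 2) - s)%:R)); last by rewrite natrB //; ring.
rewrite expRD expRD [X in _ <= _ * (_ * (_ * X))]expRM_natr.
rewrite mulrCA ler_wpM2l ?exprn_ge0 ?(ltW p0) // ler_wpM2l ?expR_ge0 // ler_wpM2l ?expR_ge0 //.
rewrite lerXn2r // nnegrE ?expR_ge0 //.
by rewrite addr_ge0 ?mulr_ge0 ?expR_ge0 //; lra.
Qed.

(** * Estimates for the exponential function *)

Lemma nincr_from0 (R : realType) (f df : R -> R) :
  (forall x : R, is_derive x 1 f (df x)) -> (forall x, 0 <= x -> df x <= 0) ->
  forall x, 0 <= x -> f x <= f 0.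
Proof.
move=> fdf df0 x x0.
apply: (@ler0_derive1_nincry _ f 0) => //.
- by move=> y; rewrite in_itv /= andbT => /ltW y0; rewrite derive1E derive_val df0.
- by apply: derivable_within_continuous => y _.
Qed.

Lemma expRN_le_quadratic (R : realType) (x : R) :
  0 <= x -> expR (- x) <= 1 - x + x ^+ 2 / 2.
Proof.
move=> x0; rewrite -subr_le0.
pose f y : R := expR (- y) - (1 - y + y ^+ 2 / 2).
have -> : 0 = f 0 by rewrite /f oppr0 expR0; ring.
apply: (@nincr_from0 _ f (fun y => - expR (- y) + 1 - y)) => // y.
  rewrite /f; apply: is_derive_eq.
  by rewrite /GRing.scale /=; field.
by move=> _; have := expR_ge1Dx (- y); lra.
Qed.

(** The function $(1-y)e^{y+y^2/2}$ has derivative $-y^2e^{y+y^2/2}$. The quadratic term is what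
    later improves the variance factor from [p] to [p * (1 - p)]. *)
Lemma oneB_le_expRN (R : realType) (x : R) :
  0 <= x -> 1 - x <= expR (- (x + x ^+ 2 / 2)).
Proof.
move=> x0; rewrite expRN -[leRHS]mul1r ler_pdivlMr ?expR_gt0 //.
pose f y : R := (1 - y) * expR (y + y ^+ 2 / 2).
have f0 : f 0 = 1 by rewrite /f expr0n /= mul0r addr0 expR0; ring.
rewrite -[leRHS]f0.
apply: (@nincr_from0 _ f (fun y => - y ^+ 2 * expR (y + y ^+ 2 / 2))) => // y.
  rewrite /f; apply: is_derive_eq.
  by rewrite /GRing.scale /=; field.
by move=> _; rewrite mulNr oppr_le0 mulr_ge0 ?expR_ge0 ?sqr_ge0.
Qed.

(** The quadratic bound on [expR (- th)] leaves [1 - x] with [x = p * (th - th ^+ 2 / 2)]; the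
    second-order bound on [1 - x] follows, and the term $p^2\theta^4/8$ of $x^2/2$ is dropped. *)
Lemma tilt_down_le (R : realType) (p th : R) : 0 < p < 1 -> 0 <= th <= 1 ->
  1 - p + p * expR (- th) <=
  expR (- (p * th - p * (1 - p) * th ^+ 2 / 2 - p ^+ 2 * th ^+ 3 / 2)).
Proof.
move=> /andP[p0 p1] /andP[t0 t1].
pose x := p * (th - th ^+ 2 / 2).
have x0 : 0 <= x by rewrite /x mulr_ge0 ?(ltW p0) //; nra.
apply: (@le_trans _ _ (1 - x)).
  by have := ler_wpM2l (ltW p0) (expRN_le_quadratic t0); rewrite /x; lra.
apply: (le_trans (oneB_le_expRN x0)); rewrite ler_expR lerN2 -subr_ge0.
have -> : x + x ^+ 2 / 2 - (p * th - p * (1 - p) * th ^+ 2 / 2 - p ^+ 2 * th ^+ 3 / 2) =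
  p ^+ 2 * th ^+ 4 / 8 by rewrite /x; field.
by rewrite divr_ge0 // mulr_ge0 ?exprn_ge0 // ltW.
Qed.

Lemma tilt_up_le (R : realType) (p th : R) : 0 < p < 1 -> 0 <= th <= 1 / 2 ->
  1 - p + p * expR th <= expR (p * th + 2 * p * th ^+ 2).
Proof.
move=> /andP[p0 p1] /andP[t0 t1].
apply: le_trans (expR_ge1Dx _).
suff : expR th <= 1 + th + 2 * th ^+ 2 by move/(ler_wpM2l (ltW p0)); lra.
have e0 := expR_gt0 th; have := expR_ge1Dx (- th).
rewrite expRN -[leRHS]mul1r ler_pdivlMr // => h.
(* This quantity is $(1-\theta)(1+\theta+2\theta^2)-1$, so $1/(1-\theta)$, which bounds $e^\theta$,
   is at most $1+\theta+2\theta^2$. *)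
have : 0 <= th ^+ 2 * (1 - 2 * th) by rewrite mulr_ge0 ?sqr_ge0 //; lra.
move=> h2; rewrite -(@ler_pM2l _ (1 - th)); last by lra.
by apply: (le_trans (y := 1)) => //; lra.
Qed.

(** * Binomial coefficients and powers *)

Lemma natr_bin2 (R : realType) n : 'C(n, 2)%:R = n%:R * (n%:R - 1) / 2 :> R.
Proof.
elim: n => [|n IH]; first by rewrite bin0n mul0r mul0r.
by rewrite binS bin1 natrD IH -natr1; field.
Qed.

Lemma natr_bin2_le (R : realType) n : 'C(n, 2)%:R <= n%:R ^+ 2 / 2 :> R.
Proof. by rewrite natr_bin2; have : 0 <= n%:R :> R by []; lra. Qed.

Lemma natr_bin2_ge (R : realType) n : (2 <= n)%N -> n%:R ^+ 2 / 4 <= 'C(n, 2)%:R :> R.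
Proof. by rewrite -(ler_nat R) natr_bin2 => n2; nra. Qed.

Lemma ffact_le_exp n k : (n ^_ k <= n ^ k)%N.
Proof. by elim: k => // k IH; rewrite ffactnSr expnSr leq_mul // leq_subr. Qed.

(** Follows from $r^r/r!\le e^r$, a single term of the exponential series. *)
Lemma bin_le_expR (R : realType) A r : (0 < r)%N ->
  'C(A, r)%:R <= (A%:R * expR 1 / r%:R) ^+ r :> R.
Proof.
move=> r0; have rR : 0 < r%:R :> R by rewrite ltr0n.
have h1 : 'C(A, r)%:R * r`!%:R <= A%:R ^+ r :> R.
  by rewrite -natrM -natrX ler_nat bin_ffact ffact_le_exp.
have f0 : 0 < r`!%:R :> R by rewrite ltr0n fact_gt0.
have h2 : r%:R ^+ r <= r`!%:R * expR 1 ^+ r :> R.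
  have := expR_ge1Dxn r.-1 (ltW rR); rewrite prednK // -[expR r%:R](congr1 expR (mul1r _)) expRM_natr => h.
  rewrite mulrC -ler_pdivrMr //; apply: le_trans h; by rewrite lerDr.
rewrite exprMn exprVn ler_pdivlMr ?exprn_gt0 //.
apply: (le_trans (ler_wpM2l (ler0n _ _) h2)).
by rewrite mulrA exprMn ler_wpM2r ?exprn_ge0 ?expR_ge0.
Qed.

(** The term of degree [d.+1] of the exponential series already beats [a * x ^+ d]. With [x = ln n]
    this compares powers of the logarithm with powers of [n]. *)
Lemma pow_le_expR (R : realType) (a c : R) (d : nat) : 0 < c ->
  exists M : R, forall x, M <= x -> a * x ^+ d <= expR (c * x).
Proof.
move=> c0; have f0 : 0 < (d.+1)`!%:R :> R by rewrite ltr0n fact_gt0.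
exists (Num.max 0 (a * (d.+1)`!%:R / c ^+ d.+1)) => x.
rewrite ge_max => /andP[x0 ax].
have := expR_ge1Dxn d (mulr_ge0 (ltW c0) x0).
apply: le_trans; apply: (@le_trans _ _ ((c * x) ^+ d.+1 / (d.+1)`!%:R)).
  rewrite ler_pdivlMr // exprMn [x ^+ d.+1]exprSr.
  move: ax; rewrite ler_pdivrMr ?exprn_gt0 // => ax.
  have := ler_wpM2r (exprn_ge0 d x0) ax; lra.
by rewrite lerDr.
Qed.

(** * The expected number of cliques and the size of [k0] *)

Definition clique_mean (R : realType) (p : R) n k : R :=
  'C(n, k)%:R * p ^+ 'C(k, 2).

Lemma clique_mean_k0 (R : realType) (p : R) n : clique_mean p n (k0 p n) < 1.
Proof. by rewrite /k0; case: ex_minnP. Qed.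

Lemma clique_mean_below_k0 (R : realType) (p : R) n k :
  (k < k0 p n)%N -> 1 <= clique_mean p n k.
Proof.
rewrite /k0; case: ex_minnP => j _ jmin kj; rewrite leNgt; apply/negP => h.
by have := jmin k h; rewrite leqNgt kj.
Qed.

Lemma k0_ge2 (R : realType) (p : R) n : (0 < n)%N -> (2 <= k0 p n)%N.
Proof.
move=> n0; have := clique_mean_k0 p n; rewrite /clique_mean.
case: (k0 p n) => [|[|k]] //; first by rewrite bin0 mul1r ltxx.
by rewrite bin1 mulr1 ltrn1 ltnNge n0.
Qed.

Lemma mul2_bin2 k : ('C(k, 2) * 2 = k.-1 * k)%N.
Proof. by rewrite mulnC mul_bin_left bin1 subn1. Qed.

Lemma bin_le_exp n k : ('C(n, k) <= n ^ k)%N.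
Proof.
apply: leq_trans (ffact_le_exp n k).
by rewrite -bin_ffact leq_pmulr // fact_gt0.
Qed.

Lemma exp_le_bin n k : ((n - k) ^ k <= 'C(n, k) * k ^ k)%N.
Proof.
have h1 j : (j <= k -> (n - k) ^ j <= n ^_ j)%N.
  elim: j => // j IH jk; rewrite ffactnSr expnSr leq_mul ?IH ?(ltnW jk) //; lia.
have h2 j : (j <= k -> j`! <= k ^ j)%N.
  elim: j => // j IH jk; rewrite factS expnS leq_mul ?IH ?(ltnW jk) //.
apply: (leq_trans (h1 _ (leqnn k))); rewrite -bin_ffact leq_mul //; exact: h2.
Qed.

(** The mean at [k0 - 1] is at least 1 and at most $n^{k_0-1}p^{\binom{k_0-1}{2}}$; squaring and
    taking the root of order [k0 - 1] gives the claim. It says that [k0] is at most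
    $2\log_{1/p}n+2$. *)
Lemma k0_upper (R : realType) (p : R) n : 0 < p < 1 -> (0 < n)%N ->
  1 <= n%:R ^+ 2 * p ^+ (k0 p n - 2).
Proof.
move=> /andP[p0 p1] n0; have := k0_ge2 p n0; have := @clique_mean_below_k0 _ p n (k0 p n).-1.
case: (k0 p n) => [|[|k]] //= /(_ (leqnn _)) h _; rewrite subn2 /=.
have {}h : 1 <= n%:R ^+ k.+1 * p ^+ 'C(k.+1, 2).
  apply: (le_trans h); rewrite /clique_mean ler_wpM2r ?exprn_ge0 ?(ltW p0) //.
  by rewrite -natrX ler_nat bin_le_exp.
have := exprn_ege1 2 h; rewrite exprMn -!exprM mul2_bin2 /= mulnC !exprM -exprMn.
apply: contraLR; rewrite -!ltNge => h2; rewrite exprn_ilt1 // ?mulr_ge0 ?exprn_ge0 ?ler0n ?(ltW p0) //.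
Qed.

(** Downward induction from the mean at [k0], which is below 1. One step down from [j.+1] to [j]
    multiplies the mean by $(j+1)/((n-j)p^j)$, where $n-j\ge n/2$ and $p^j\ge p^2/n^2$ by
    [k0_upper]. *)
Lemma clique_mean_below_le (R : realType) (p : R) n d : 0 < p < 1 -> (0 < n)%N ->
  (2 * k0 p n <= n)%N -> (d <= k0 p n)%N ->
  clique_mean p n (k0 p n - d) <= (2 * (k0 p n)%:R * n%:R / p ^+ 2) ^+ d.
Proof.
move=> hp n0 kn; have /andP[p0 p1] := hp.
have nR : 0 < n%:R :> R by rewrite ltr0n.
have p20 : 0 < p ^+ 2 by rewrite exprn_gt0.
elim: d => [|d IH] dk; first by rewrite subn0 expr0 ltW // clique_mean_k0.
have {}IH := IH (ltnW dk); set j := (k0 p n - d.+1)%N.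
have jE : (k0 p n - d = j.+1)%N by rewrite /j; lia.
rewrite jE in IH.
have rec : clique_mean p n j.+1 * j.+1%:R = (n - j)%:R * p ^+ j * clique_mean p n j.
  rewrite /clique_mean binS bin1 exprD.
  have := congr1 (fun x => x%:R : R) (mul_bin_left n j); rewrite !natrM => E.
  transitivity (p ^+ 'C(j, 2) * p ^+ j * (j.+1%:R * 'C(n, j.+1)%:R)); first by ring.
  by rewrite E; ring.
have pj : p ^+ 2 <= n%:R ^+ 2 * p ^+ j.
  have := k0_upper hp n0 => h.
  have e : p ^+ (k0 p n) <= p ^+ j by rewrite ler_wiXn2l ?(ltW p0) ?(ltW p1) // /j leq_subr.
  apply: le_trans (ler_wpM2l (ltW (exprn_gt0 2 nR)) e).
  rewrite -[k0 p n](subnK (k0_ge2 p n0)) exprD mulrA -[leLHS]mul1r.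
  by rewrite ler_wpM2r // ltW.
have nj : n%:R <= 2 * (n - j)%:R :> R by rewrite -natrM ler_nat; lia.
have jk : j.+1%:R <= (k0 p n)%:R :> R by rewrite ler_nat -jE leq_subr.
have m0 i : 0 <= clique_mean p n i by rewrite mulr_ge0 ?exprn_ge0 ?(ltW p0).
rewrite exprS; apply: le_trans (ler_wpM2l _ IH); last first.
  by rewrite divr_ge0 ?(ltW p20) // !mulr_ge0.
rewrite mulrAC ler_pdivlMr // -(@ler_pM2l _ n%:R) //.
apply: (@le_trans _ _ (2 * n%:R ^+ 2 * ((n - j)%:R * p ^+ j * clique_mean p n j))).
  have := ler_pM (ltW nR) (ltW p20) nj pj => /(ler_wpM2r (m0 j)); lra.
rewrite -rec; have := ler_wpM2l (m0 j.+1) jk => /(ler_wpM2l (ltW (exprn_gt0 2 nR))); lra.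
Qed.

(** The mean at [k0] is below 1 and at least $(n/(2k_0))^{k_0}p^{\binom{k_0}{2}}$; squaring and
    taking the root of order [k0] gives $(n/(2k_0))^2p^{k_0-1}<1$, and $4k_0^2\le n$ absorbs the
    denominator. *)
Lemma k0_lower (R : realType) (p : R) n : 0 < p < 1 -> (0 < n)%N ->
  (2 * k0 p n <= n)%N -> (4 * k0 p n ^ 2 <= n)%N ->
  n%:R * p ^+ (k0 p n).-1 < 1.
Proof.
move=> /andP[p0 p1] n0; have := clique_mean_k0 p n; have := k0_ge2 p n0.
move: (k0 p n) => k k2 hk kn kkn.
have nR : 0 < n%:R :> R by rewrite ltr0n.
have kR : 0 < k%:R :> R by rewrite ltr0n; lia.
have h1 : (n%:R / (2 * k%:R)) ^+ k <= 'C(n, k)%:R :> R.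
  rewrite exprMn exprVn ler_pdivrMr ?exprn_gt0 ?mulr_gt0 // exprMn.
  have : ((n - k)%:R ^+ k <= 'C(n, k)%:R * k%:R ^+ k :> R).
    by rewrite -!natrX -natrM ler_nat exp_le_bin.
  have : n%:R ^+ k <= 2 ^+ k * (n - k)%:R ^+ k :> R.
    rewrite -exprMn lerXn2r ?nnegrE ?mulr_ge0 //.
    by rewrite -natrM ler_nat; lia.
  move=> a1 a2; apply: (le_trans a1); rewrite mulrCA ler_wpM2l ?exprn_ge0 //.
have h2 : (n%:R / (2 * k%:R)) ^+ k * p ^+ 'C(k, 2) < 1.
  by apply: le_lt_trans hk; rewrite ler_wpM2r ?exprn_ge0 ?(ltW p0).
have b0 : 0 <= n%:R / (2 * k%:R) :> R by rewrite divr_ge0 // mulr_ge0.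
have h3 : (n%:R / (2 * k%:R)) ^+ 2 * p ^+ k.-1 < 1.
  rewrite ltNge; apply/negP => /(exprn_ege1 k); rewrite leNgt => /negP; apply.
  rewrite exprMn -!exprM -mul2_bin2 mulnC !exprM -exprMn exprn_ilt1 //.
  by rewrite mulr_ge0 // exprn_ge0 // ltW.
move: h3; rewrite exprMn exprVn mulrAC ltr_pdivrMr ?exprn_gt0 ?mulr_gt0 // mul1r.
have : 4 * k%:R ^+ 2 <= n%:R :> R by rewrite -natrX -natrM ler_nat.
rewrite exprMn => a1 a2; rewrite -(@ltr_pM2l _ n%:R) // mulr1.
apply: lt_le_trans a1; move: a2; rewrite expr2 -mulrA; lra.
Qed.

(** * The Chernoff bound with explicit tilt *)

Local Open Scope classical_set_scope.
Local Open Scope ring_scope.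

Lemma Gnp_prob_cliques_chernoff (R : realType) (p th1 t m : R) n k r :
  let N : R := 'C(n, 2)%:R in let K : R := 'C(k, 2)%:R in
  0 < p < 1 -> 0 < N -> 0 <= th1 <= 1 / 2 ->
  (forall j : nat, m <= j%:R -> (r <= j)%N) -> (0 < r)%N ->
  r%:R * K <= N * p ->
  Gnp_prob p (@has_edge_disjoint_cliques R n k m) <=
  expR (2 * p * N * th1 ^+ 2 - th1 * t) +
  (clique_mean p n k * expR 1 / r%:R *
   expR (K * t / (N * p) - r%:R * K ^+ 2 * (1 - p) / (2 * N * p) +
         r%:R ^+ 2 * K ^+ 3 / (2 * N ^+ 2 * p))) ^+ r.
Proof.
move=> N K hp N0 hth1 hr r0 rKN; have /andP[p0 p1] := hp; have /andP[th10 _] := hth1.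
have N0' : N != 0 by rewrite gt_eqF.
have p0' : p != 0 by rewrite gt_eqF.
have K0 : 0 <= K by rewrite ler0n.
(* This value minimises the main part $-(1-p)\theta rK+Np(1-p)\theta^2/2$ of the exponent; [rKN]
   makes it at most 1. *)
pose th := r%:R * K / (N * p).
have th0 : 0 <= th by rewrite divr_ge0 ?mulr_ge0 ?ler0n // ltW.
have th1' : th <= 1 by rewrite ler_pdivrMr ?mulr_gt0 // mul1r.
have hth : 0 <= th <= 1 by rewrite th0.
have := Gnp_prob_cliques_le (p * N + t) n k hp th10 th0 hr
  (tilt_up_le hp hth1) (tilt_down_le hp hth).
move=> h; apply: (le_trans h) => {h}.
apply: lerD; first by rewrite ler_expR -/N; lra.
rewrite natrM -/K -/N.
set u := p * th - _ - _.
have hu : th * (p * N + t) - th * (r%:R * K) - u * (N - r%:R * K) <=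
    r%:R * (K * t / (N * p) - r%:R * K ^+ 2 * (1 - p) / (2 * N * p) +
         r%:R ^+ 2 * K ^+ 3 / (2 * N ^+ 2 * p)).
  have q0 : 0 <= 1 - p by lra.
  (* The terms of [u] of order two and three, multiplied by [r * K], only lower the exponent and are
     discarded. *)
  have v0 : 0 <= (r%:R * K) * (p * (1 - p) * th ^+ 2 / 2 + p ^+ 2 * th ^+ 3 / 2).
    have p0w := ltW p0.
    apply: mulr_ge0; first by rewrite mulr_ge0.
    clearbody th; apply: addr_ge0; apply: divr_ge0 => //; rewrite !mulr_ge0 ?exprn_ge0 //.
  apply: (@le_trans _ _ (th * t - (1 - p) * th * (r%:R * K) +
     N * (p * (1 - p) * th ^+ 2 / 2 + p ^+ 2 * th ^+ 3 / 2))).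
    by rewrite -subr_ge0; move: v0; rewrite /u; lra.
  rewrite le_eqVlt; apply/orP; left; apply/eqP; rewrite /th; field.
  by rewrite N0' p0'.
have pK0 : 0 <= p ^+ 'C(k, 2) by rewrite exprn_ge0 // ltW.
rewrite exprM.
rewrite [in leRHS]exprMn -expRM_natl.
apply: (@le_trans _ _ (('C(n, k)%:R * expR 1 / r%:R) ^+ r * (p ^+ 'C(k, 2) ^+ r *
    expR (r%:R * (K * t / (N * p) - r%:R * K ^+ 2 * (1 - p) / (2 * N * p) +
         r%:R ^+ 2 * K ^+ 3 / (2 * N ^+ 2 * p)))))).
  apply: ler_pM => //; first by rewrite mulr_ge0 ?exprn_ge0 ?expR_ge0 // ltW.
    exact: bin_le_expR.
  rewrite -!exprM [(r * _)%N]mulnC; apply: ler_wpM2l; first by rewrite exprn_ge0 // ltW.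
  by rewrite ler_expR.
rewrite mulrA -[X in X * _ <= _]exprMn /clique_mean.
by rewrite (_ : 'C(n, k)%:R * p ^+ 'C(k, 2) * expR 1 / r%:R =
  'C(n, k)%:R * expR 1 / r%:R * p ^+ 'C(k, 2)) //; ring.
Qed.

(** * The exponent per clique *)

Lemma ler_pdiv2 (R : realType) (x x' y y' : R) :
  0 <= x -> x <= x' -> 0 < y' -> y' <= y -> x / y <= x' / y'.
Proof.
move=> x0 xx y0 yy; apply: ler_pM => //; first by rewrite invr_ge0 (le_trans (ltW y0)).
by rewrite lef_pV2 // posrE // (lt_le_trans y0).
Qed.

(** The first term is the cost of the [t] surplus edges, of order [1 / k]; the third is the cubic
    error, of order [L ^+ 2 / k ^+ 2]. Both are at most [L / 32]. The middle term is the gain that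
    has to beat the union bound. *)
Lemma exponent_le (R : realType) (p c D L : R) (n k r : nat) :
  let N : R := 'C(n, 2)%:R in let K : R := 'C(k, 2)%:R in
  let m := c * (n%:R ^+ 2 * L / k%:R ^+ 4) in
  let t := n%:R ^+ 2 / k%:R ^+ 3 in
  0 < p < 1 -> c = 5 * D * p / (1 - p) -> 0 < D -> 0 < L -> (2 <= n)%N -> (20 <= k)%N ->
  m <= r%:R -> r%:R <= 2 * m ->
  2 / (p * k%:R) <= L / 32 -> 4 * c ^+ 2 * L ^+ 2 / (p * k%:R ^+ 2) <= L / 32 ->
  K * t / (N * p) - r%:R * K ^+ 2 * (1 - p) / (2 * N * p) +
         r%:R ^+ 2 * K ^+ 3 / (2 * N ^+ 2 * p) <= L / 16 - 9 / 8 * D * L.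
Proof.
move=> N K m t /andP[p0 p1] cE D0 L0 n2 k20 mr r2m h1 h2.
have q0 : 0 < 1 - p by lra.
have c0 : 0 < c by rewrite cE divr_gt0 ?mulr_gt0.
have n2R : 2 <= n%:R :> R by rewrite ler_nat.
have k20R : 20 <= k%:R :> R by rewrite ler_nat.
have n0 : 0 < n%:R :> R by lra.
have k0 : 0 < k%:R :> R by lra.
have m0 : 0 < m by rewrite /m !mulr_gt0 ?invr_gt0 ?exprn_gt0.
have t0 : 0 < t by rewrite /t divr_gt0 ?exprn_gt0.
have mE : m = c * (n%:R ^+ 2 * L / k%:R ^+ 4) by [].
have tE : t = n%:R ^+ 2 / k%:R ^+ 3 by [].
clearbody m t.
have Nlo : n%:R ^+ 2 / 4 <= N := natr_bin2_ge R n2.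
have Nhi : N <= n%:R ^+ 2 / 2 := natr_bin2_le R n.
(* For [k >= 20] one loses a factor of at most $(19/20)^2$ against $k^4/4$, and $361/1600\ge9/40$.
   The constant 5 in [c] then yields the gain $5\cdot9/40=9/8$. *)
have Klo : 9 / 40 * k%:R ^+ 4 <= K ^+ 2.
  have h : (19 / 20 * k%:R) ^+ 2 <= (k%:R - 1) ^+ 2 :> R.
    by rewrite lerXn2r ?nnegrE; lra.
  have kk : 0 <= k%:R ^+ 2 :> R by rewrite exprn_ge0 // ltW.
  have k4 : 0 <= k%:R ^+ 4 :> R by rewrite exprn_ge0 // ltW.
  rewrite /K natr_bin2; move: (ler_wpM2l kk h); lra.
have Khi : K <= k%:R ^+ 2 / 2 := natr_bin2_le R k.
have K0 : 0 <= K by rewrite ler0n.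
have r0 : 0 <= r%:R :> R by rewrite ler0n.
have nn0 : 0 < n%:R ^+ 2 / 4 :> R by rewrite divr_gt0 ?exprn_gt0.
have N0 : 0 < N by rewrite (lt_le_trans nn0).
have E1 : K * t / (N * p) <= 2 / (p * k%:R).
  apply: (@le_trans _ _ ((k%:R ^+ 2 / 2 * t) / (n%:R ^+ 2 / 4 * p))).
    apply: ler_pdiv2; rewrite ?mulr_ge0 ?mulr_gt0 ?(ltW t0) //.
      by rewrite ler_wpM2r // ltW.
    by rewrite ler_wpM2r // ltW.
  rewrite le_eqVlt; apply/orP; left; apply/eqP; rewrite tE; field.
  by rewrite !gt_eqF.
have E2 : 9 / 8 * D * L <= r%:R * K ^+ 2 * (1 - p) / (2 * N * p).
  have -> : 9 / 8 * D * L =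
      (m * (9 / 40 * k%:R ^+ 4) * (1 - p)) / (2 * (n%:R ^+ 2 / 2) * p).
    by rewrite mE cE; field; rewrite !gt_eqF.
  apply: ler_pdiv2.
  - by rewrite !mulr_ge0 ?exprn_ge0 ?divr_ge0 ?(ltW m0) ?(ltW q0).
  - rewrite ler_wpM2r ?(ltW q0) //; apply: ler_pM; rewrite ?(ltW m0) //.
  - by rewrite !mulr_gt0.
  - by rewrite ler_wpM2r ?(ltW p0) // ler_wpM2l.
have E3 : r%:R ^+ 2 * K ^+ 3 / (2 * N ^+ 2 * p) <= 4 * c ^+ 2 * L ^+ 2 / (p * k%:R ^+ 2).
  apply: (@le_trans _ _ (((2 * m) ^+ 2 * (k%:R ^+ 2 / 2) ^+ 3) /
       (2 * (n%:R ^+ 2 / 4) ^+ 2 * p))).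
    apply: ler_pdiv2.
    - by rewrite mulr_ge0 ?exprn_ge0.
    - apply: ler_pM; rewrite ?exprn_ge0 //.
        by rewrite lerXn2r ?nnegrE // mulr_ge0 // ltW.
      by rewrite lerXn2r ?nnegrE // divr_ge0 // exprn_ge0.
    - by rewrite !mulr_gt0 // exprn_gt0.
    - rewrite ler_wpM2r ?(ltW p0) // ler_wpM2l // lerXn2r // nnegrE; exact: ltW.
  rewrite le_eqVlt; apply/orP; left; apply/eqP; rewrite mE; field.
  by rewrite !gt_eqF.
lra.
Qed.

(** * Estimates for large [n] *)

Lemma least_nat_ge (R : realType) (m : R) : 0 <= m ->
  exists r : nat, [/\ m <= r%:R, r%:R <= m + 1 & forall j : nat, m <= j%:R -> (r <= j)%N].
Proof.
move=> m0; have ex : exists r : nat, m <= r%:R.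
  by exists (Num.trunc m).+1; exact: ltW (truncnS_gt m).
case: (ex_minnP ex) => r mr rmin; exists r; split=> //.
apply: (@le_trans _ _ (Num.trunc m).+1%:R).
  by rewrite ler_nat rmin // ltW // truncnS_gt.
by rewrite -natr1 lerD2r truncn_le.
Qed.

Lemma ln_near_infty (R : realType) (M : R) : \forall n \near \oo, M <= ln n%:R.
Proof.
near=> n; have h : expR M <= n%:R by near: n; exact: nbhs_infty_ger.
rewrite -[leLHS]expRK ler_ln // posrE ?expR_gt0 //.
exact: lt_le_trans (expR_gt0 M) h.
Unshelve. all: by end_near.
Qed.

Lemma k0_le_ln (R : realType) (p : R) n : 0 < p < 1 -> (0 < n)%N ->
  ((k0 p n)%:R - 2) * - ln p <= 2 * ln n%:R.
Proof.
move=> hp n0; have := k0_upper hp n0; have := k0_ge2 p n0.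
case/andP: hp => p0 _; move: (k0 p n) => k k2.
have nE : n%:R = expR (ln n%:R) :> R by rewrite lnK // posrE ltr0n.
have pE : p = expR (ln p) by rewrite lnK.
rewrite {1}nE {1}pE -!expRM_natl -expRD -[X in X <= _ -> _]expR0 ler_expR natrB //; lra.
Qed.

Lemma ln_lt_k0 (R : realType) (p : R) n : 0 < p < 1 -> (0 < n)%N ->
  (2 * k0 p n <= n)%N -> (4 * k0 p n ^ 2 <= n)%N ->
  ln n%:R < ((k0 p n)%:R - 1) * - ln p.
Proof.
move=> hp n0 h1 h2; have := k0_lower hp n0 h1 h2; have := k0_ge2 p n0.
case/andP: hp => p0 _; move: (k0 p n) => k k2.
have nE : n%:R = expR (ln n%:R) :> R by rewrite lnK // posrE ltr0n.
have pE : p = expR (ln p) by rewrite lnK.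
rewrite {1}nE {1}pE -!expRM_natl -expRD -[X in _ < X -> _]expR0 ltr_expR -subn1 natrB; last by lia.
lra.
Qed.

(** Combines the logarithmic forms of [k0_upper] and [k0_lower]; the crude upper bound [3 * L / b]
    and the last hypothesis supply the smallness of [k0] that the lower bound requires. *)
Lemma k0_bounds (R : realType) (p : R) n :
  let b := - ln p in let L := ln n%:R in
  0 < p < 1 -> (0 < n)%N -> 0 < b -> 0 < L -> 2 * b <= L ->
  8 * (3 / b) ^+ 6 * L ^+ 6 <= n%:R ->
  [/\ 8 * (k0 p n)%:R ^+ 6 <= n%:R :> R, (2 * k0 p n <= n)%N,
      (k0 p n)%:R <= 3 * L / b & L / b + 1 < (k0 p n)%:R].
Proof.
move=> b L hp n0 b0 L0 Lb F.
have kb := k0_le_ln hp n0; rewrite -/b -/L in kb.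
have k0hi : (k0 p n)%:R <= 3 * L / b by rewrite ler_pdivlMr //; lra.
have k1 := ltnW (k0_ge2 p n0).
have k06 : 8 * (k0 p n)%:R ^+ 6 <= n%:R :> R.
  apply: le_trans F; rewrite -mulrA ler_wpM2l // -exprMn lerXn2r ?nnegrE //.
    by rewrite mulr_ge0 ?divr_ge0 // ltW.
  by apply: (le_trans k0hi); rewrite mulrAC.
have k06n : (8 * k0 p n ^ 6 <= n)%N by rewrite -(ler_nat R) natrM natrX.
have kn4 : (4 * k0 p n ^ 2 <= n)%N.
  by apply: leq_trans k06n; apply: leq_mul => //; apply: leq_pexp2l.
have kn2 : (2 * k0 p n <= n)%N.
  by apply: leq_trans kn4; rewrite leq_mul // -[leqLHS]expn1 leq_pexp2l.
split=> //; rewrite -ltrBrDr ltr_pdivrMr //; exact: ln_lt_k0.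
Qed.

(** The chosen [th] minimises $n^2\theta^2-\theta n^2/k^3$, with minimum $-n^2/(4k^6)$. *)
Lemma upper_tail_exponent_le (R : realType) (p : R) n k :
  let th : R := 1 / (2 * k%:R ^+ 3) in
  0 < p < 1 -> (0 < k)%N -> 8 * k%:R ^+ 6 <= n%:R :> R ->
  2 * p * 'C(n, 2)%:R * th ^+ 2 - th * (n%:R ^+ 2 / k%:R ^+ 3) <= - (2 * n%:R).
Proof.
move=> th /andP[p0 p1] k1 k6; have kR0 : 0 < k%:R :> R by rewrite ltr0n.
have -> : th * (n%:R ^+ 2 / k%:R ^+ 3) = n%:R ^+ 2 / (2 * k%:R ^+ 6).
  by rewrite /th; field; rewrite gt_eqF.
apply: (@le_trans _ _ (2 * (n%:R ^+ 2 / 2) * th ^+ 2 - n%:R ^+ 2 / (2 * k%:R ^+ 6))).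
  rewrite lerD2r ler_wpM2r ?sqr_ge0 // -mulrA ler_wpM2l //.
  by apply: le_trans (natr_bin2_le R n); rewrite ler_piMl // ltW.
have -> : 2 * (n%:R ^+ 2 / 2) * th ^+ 2 - n%:R ^+ 2 / (2 * k%:R ^+ 6) =
  - (n%:R * (n%:R / (4 * k%:R ^+ 6))) :> R.
  by rewrite /th; field; rewrite gt_eqF.
by rewrite lerN2 mulrC ler_wpM2l // ler_pdivlMr ?mulr_gt0 ?exprn_gt0 //; lra.
Qed.

(** A gain of [L / 8] in the exponent for each clique thus amounts to at least [2 * n] in total. The
    constant is $1296=16\cdot3^4$. *)
Lemma family_size_ge (R : realType) (b c L : R) n k :
  0 < b -> 0 < c -> 0 < L -> (0 < n)%N -> (0 < k)%N -> k%:R <= 3 * L / b ->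
  1296 / (c * b ^+ 4) * L ^+ 2 <= n%:R ->
  16 * n%:R <= c * (n%:R ^+ 2 * L / k%:R ^+ 4) * L.
Proof.
move=> b0 c0 L0 n0 k1 khi F; have nR0 : 0 < n%:R :> R by rewrite ltr0n.
have kR0 : 0 < k%:R :> R by rewrite ltr0n.
have Lb3 : 0 <= 3 * L / b by rewrite divr_ge0 ?mulr_ge0 // ltW.
apply: (@le_trans _ _ (c * (n%:R ^+ 2 * L / (3 * L / b) ^+ 4) * L)); last first.
  rewrite ler_wpM2r ?(ltW L0) // ler_wpM2l ?(ltW c0) //; apply: ler_pdiv2 => //.
  - by rewrite mulr_ge0 ?exprn_ge0 // ltW.
  - by rewrite exprn_gt0.
  - by rewrite lerXn2r ?nnegrE.
have -> : c * (n%:R ^+ 2 * L / (3 * L / b) ^+ 4) * L =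
   n%:R * (n%:R / (81 * (L ^+ 2 / (c * b ^+ 4)))).
  by field; rewrite !gt_eqF.
rewrite mulrC ler_wpM2l ?(ltW nR0) // ler_pdivlMr; first by apply: le_trans F; lra.
by rewrite mulr_gt0 // divr_gt0 ?mulr_gt0 ?exprn_gt0.
Qed.

(** The left side has order at most $n^2L/k^2$, hence $n^2/L$ because [k] is at least of order [L].
    This keeps the tilt at most 1. *)
Lemma family_edges_le (R : realType) (p b c L : R) n k (r : nat) :
  let m := c * (n%:R ^+ 2 * L / k%:R ^+ 4) in
  0 < p -> 0 < c -> 0 < L -> (2 <= n)%N -> (0 < k)%N ->
  r%:R <= 2 * m -> L ^+ 2 / k%:R ^+ 2 <= 4 * b ^+ 2 -> 16 * c * b ^+ 2 / p <= L ->
  r%:R * 'C(k, 2)%:R <= 'C(n, 2)%:R * p.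
Proof.
move=> m p0 c0 L0 n2 k1 r2m Lk L16.
have kR0 : 0 < k%:R :> R by rewrite ltr0n.
have nn0 : 0 <= n%:R ^+ 2 :> R by rewrite sqr_ge0.
apply: (@le_trans _ _ (2 * m * (k%:R ^+ 2 / 2))).
  by apply: ler_pM => //; exact: natr_bin2_le.
apply: (@le_trans _ _ (n%:R ^+ 2 / 4 * p)); last first.
  by rewrite ler_wpM2r ?natr_bin2_ge // ltW.
have -> : 2 * m * (k%:R ^+ 2 / 2) = n%:R ^+ 2 * c * (L ^+ 2 / k%:R ^+ 2) / L.
  by rewrite /m; field; rewrite !gt_eqF.
rewrite ler_pdivrMr //.
apply: (@le_trans _ _ (n%:R ^+ 2 * c * (4 * b ^+ 2))).
  by rewrite ler_wpM2l // mulr_ge0 // ltW.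
move: L16; rewrite ler_pdivrMr // => /(ler_wpM2l nn0); lra.
Qed.

(** The mean contributes $n^C$ and division by [r] removes $n^2$, up to the polylogarithmic factor
    [L ^+ (C + 3)], which is absorbed by $n^{1/16}$. *)
Lemma clique_mean_div_le (R : realType) (p b c L : R) (C n k r : nat) :
  0 < p -> 0 < b -> 0 < c -> 0 < L -> (0 < n)%N -> (0 < k)%N -> (2 <= C)%N ->
  expR L = n%:R ->
  clique_mean p n k <= (2 * (k0 p n)%:R * n%:R / p ^+ 2) ^+ C ->
  (k0 p n)%:R <= 3 * L / b -> k%:R <= 3 * L / b ->
  c * (n%:R ^+ 2 * L / k%:R ^+ 4) <= r%:R ->
  (6 / (b * p ^+ 2)) ^+ C * expR 1 * (3 / b) ^+ 4 / c * L ^+ (C + 3) <= expR (1 / 16 * L) ->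
  clique_mean p n k * expR 1 / r%:R <= expR ((C%:R - 2) * L + 1 / 16 * L).
Proof.
move=> p0 b0 c0 L0 n0 k1 C2 nE hmean k0hi khi mr F.
have nR0 : 0 < n%:R :> R by rewrite ltr0n.
have kR0 : 0 < k%:R :> R by rewrite ltr0n.
have Lb3 : 0 < 3 * L / b by rewrite divr_gt0 ?mulr_gt0.
have cm0 : 0 <= clique_mean p n k by rewrite mulr_ge0 // exprn_ge0 // ltW.
apply: (@le_trans _ _ ((2 * (3 * L / b) * n%:R / p ^+ 2) ^+ C * expR 1 /
    (c * (n%:R ^+ 2 * L / (3 * L / b) ^+ 4)))).
  apply: ler_pdiv2.
  - by rewrite mulr_ge0 ?expR_ge0.
  - rewrite ler_wpM2r ?expR_ge0 //; apply: (le_trans hmean).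
    have p20 : 0 <= p ^+ 2 by rewrite sqr_ge0.
    have h0 : 0 <= 2 * (k0 p n)%:R * n%:R / p ^+ 2.
      by apply: divr_ge0 => //; rewrite !mulr_ge0.
    have h : 2 * (k0 p n)%:R * n%:R / p ^+ 2 <= 2 * (3 * L / b) * n%:R / p ^+ 2.
      by rewrite ler_wpM2r ?invr_ge0 // ler_wpM2r // ler_wpM2l.
    by apply: lerXn2r; rewrite // nnegrE // (le_trans h0 h).
  - by rewrite mulr_gt0 // divr_gt0 ?exprn_gt0 // mulr_gt0 ?exprn_gt0.
  - apply: le_trans mr; rewrite ler_wpM2l ?(ltW c0) //; apply: ler_pdiv2 => //.
    + by rewrite mulr_ge0 ?exprn_ge0 // ltW.
    + by rewrite exprn_gt0.
    + by rewrite lerXn2r ?nnegrE // ltW.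
have -> : (2 * (3 * L / b) * n%:R / p ^+ 2) ^+ C * expR 1 /
    (c * (n%:R ^+ 2 * L / (3 * L / b) ^+ 4)) =
   n%:R ^+ (C - 2) * ((6 / (b * p ^+ 2)) ^+ C * expR 1 * (3 / b) ^+ 4 / c * L ^+ (C + 3)).
  have -> : 2 * (3 * L / b) * n%:R / p ^+ 2 = 6 / (b * p ^+ 2) * L * n%:R.
    by field; rewrite !gt_eqF.
  have nC : n%:R ^+ C = n%:R ^+ (C - 2) * n%:R ^+ 2 :> R by rewrite -exprD subnK.
  rewrite 2!exprMn nC exprD.
  move: (_ ^+ C) (L ^+ C) (n%:R ^+ (C - 2)) => x y z.
  by field; rewrite !gt_eqF.
by rewrite expRD -natrB // expRM_natl nE ler_wpM2l ?exprn_ge0.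
Qed.

(** * Assembling the bound *)

(** Every largeness condition on [n] appears as an explicit hypothesis comparing constants or powers
    of [L] with [L] or powers of [n], so the limit argument is separate from the estimates. *)
Lemma Gnp_prob_cliques_le_expRN (R : realType) (p : R) (C n : nat) :
  let b := - ln p in let L := ln n%:R in let k := (k0 p n - C)%N in
  let D : R := C%:R - 2 in let c := 5 * D * p / (1 - p) in
  0 < p < 1 -> (4 <= C)%N -> (2 <= n)%N ->
  1 <= L -> 2 * b <= L -> 2 * b * C%:R <= L -> 40 * b <= L ->
  128 * b / p <= L -> 512 * c ^+ 2 * b ^+ 2 / p <= L -> 16 * c * b ^+ 2 / p <= L ->
  (6 / (b * p ^+ 2)) ^+ C * expR 1 * (3 / b) ^+ 4 / c * L ^+ (C + 3) <= expR (1 / 16 * L) ->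
  1296 / (c * b ^+ 4) * L ^+ 2 <= expR (1 * L) ->
  8 * (3 / b) ^+ 6 * L ^+ 6 <= expR (1 * L) ->
  Gnp_prob p (@has_edge_disjoint_cliques R n k (c * (n%:R ^+ 2 * L / k%:R ^+ 4)))
    <= expR (- n%:R).
Proof.
move=> b L k D c hp C4 n2 L1 Lb LC L40 L128 L512 L16.
have n0 : (0 < n)%N := ltnW n2.
have /andP[p0 p1] := hp.
have nR0 : 0 < n%:R :> R by rewrite ltr0n.
have D2 : 2 <= D by rewrite /D lerBrDr -natrD ler_nat.
have D0 : 0 < D by apply: lt_le_trans D2.
have c0 : 0 < c by rewrite /c divr_gt0 ?mulr_gt0 // subr_gt0.
have b0 : 0 < b by rewrite /b oppr_gt0 ln_lt0 // p0.
have L0 : 0 < L := lt_le_trans ltr01 L1.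
have nE : expR L = n%:R by rewrite /L lnK.
have nL : L <= n%:R by rewrite -nE (le_trans _ (expR_ge1Dx L)) // lerDr.
rewrite [1 * L]mul1r nE => F2 F3 F4.
have [k06 kn2 k0hi k0lo] := k0_bounds hp n0 b0 L0 Lb F4.
rewrite -/b -/L in k0hi k0lo.
have Cb : C%:R <= L / b / 2 by rewrite -mulrA -invfM ler_pdivlMr ?mulr_gt0 // mulrC [b * 2]mulrC.
have L20 : 20 <= L / b / 2 by rewrite -mulrA -invfM ler_pdivlMr ?mulr_gt0 //; clear -L40; lra.
have Ck : (C <= k0 p n)%N by rewrite -(ler_nat R); clear -k0lo Cb L20; lra.
have kE : k%:R = (k0 p n)%:R - C%:R :> R by rewrite /k natrB.
have klo : L / b / 2 <= k%:R by rewrite kE; clear -k0lo Cb; lra.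
have kk0 : (k <= k0 p n)%N by rewrite leq_subr.
have khi : k%:R <= 3 * L / b by apply: le_trans k0hi; rewrite ler_nat.
have k20 : (20 <= k)%N by rewrite -(ler_nat R) (le_trans L20).
have k1 : (0 < k)%N by exact: leq_trans k20.
have kR0 : 0 < k%:R :> R by rewrite ltr0n.
have hmean := clique_mean_below_le hp n0 kn2 Ck; rewrite -/k in hmean.
have C2 : (2 <= C)%N by exact: leq_trans C4.
have DE : D = C%:R - 2 by [].
have cE : c = 5 * D * p / (1 - p) by [].
clearbody k c D b L.
have mL := family_size_ge b0 c0 L0 n0 k1 khi F3.
set m := c * _ in mL *.
have m1 : 1 <= m.
  rewrite -(@ler_pM2r _ L) // mul1r; apply: le_trans mL; apply: (le_trans nL).
  by rewrite ler_peMl // ?(ltW nR0) // ler1n.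
have [r [mr rm rmin]] := least_nat_ge (le_trans ler01 m1).
have r2m : r%:R <= 2 * m by clear -rm m1; lra.
have rR0 : 0 < r%:R :> R by apply: lt_le_trans mr; exact: lt_le_trans m1.
have r0 : (0 < r)%N by rewrite -(ltr0n R).
have Lk : L / k%:R <= 2 * b.
  by move: klo; rewrite -mulrA -invfM ler_pdivrMr ?mulr_gt0 // ler_pdivrMr // mulrC [b * 2]mulrC.
have Lk0 : 0 <= L / k%:R by rewrite divr_ge0 // ltW.
have Lk2 : L ^+ 2 / k%:R ^+ 2 <= 4 * b ^+ 2.
  rewrite (_ : 4 * b ^+ 2 = (2 * b) ^+ 2); last by ring.
  by rewrite -expr_div_n lerXn2r // nnegrE mulr_ge0 // ltW.
have rKN := family_edges_le p0 c0 L0 n2 k1 r2m Lk2 L16.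
pose th : R := 1 / (2 * k%:R ^+ 3).
have k3 : 1 <= k%:R ^+ 3 :> R by rewrite exprn_ege1 // ler1n.
have hth : 0 <= th <= 1 / 2.
  rewrite divr_ge0 ?mulr_ge0 ?exprn_ge0 //=; apply: ler_pdiv2 => //.
  by rewrite ler_peMr.
have N0 : 0 < 'C(n, 2)%:R :> R by rewrite ltr0n bin_gt0.
have h := @Gnp_prob_cliques_chernoff R p th (n%:R ^+ 2 / k%:R ^+ 3) m n k r
  hp N0 hth rmin r0 rKN.
apply: (le_trans h) => {h}.
have T1 := upper_tail_exponent_le hp k1 (le_trans (ler_wpM2l (ler0n _ _)
  (lerXn2r 6 (ler0n R k) (ler0n R (k0 p n)) (_ : k%:R <= (k0 p n)%:R))) k06).
have {}T1 : expR (2 * p * 'C(n, 2)%:R * th ^+ 2 - th * (n%:R ^+ 2 / k%:R ^+ 3)) <=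
    expR (- (2 * n%:R)) by rewrite ler_expR T1 // ler_nat.
have E1 : 2 / (p * k%:R) <= L / 32.
  have -> : 2 / (p * k%:R) = 2 / (p * L) * (L / k%:R) by field; rewrite !gt_eqF.
  apply: (@le_trans _ _ (2 / (p * L) * (2 * b))).
    by rewrite ler_wpM2l // divr_ge0 // mulr_ge0 // ltW.
  rewrite mulrAC ler_pdivrMr ?mulr_gt0 //.
  move: L128; rewrite ler_pdivrMr // => L128.
  by have := ler_wpM2r (ltW (mulr_gt0 L0 p0)) L1; clear -L128; lra.
have E2 : 4 * c ^+ 2 * L ^+ 2 / (p * k%:R ^+ 2) <= L / 32.
  rewrite [leLHS](_ : _ = 4 * c ^+ 2 * (L ^+ 2 / k%:R ^+ 2) / p); last first.
    by field; rewrite !gt_eqF.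
  rewrite ler_pdivrMr //; move: L512; rewrite ler_pdivrMr // => L512.
  by have := ler_wpM2l (ltW (exprn_gt0 2 c0)) Lk2; clear -L512; lra.
have E := exponent_le hp cE D0 L0 n2 k20 mr r2m E1 E2.
have B := clique_mean_div_le p0 b0 c0 L0 n0 k1 C2 nE hmean k0hi khi mr F2.
rewrite -DE in B.
have B0 : 0 <= clique_mean p n k * expR 1 / r%:R.
  by rewrite divr_ge0 // mulr_ge0 ?expR_ge0 // mulr_ge0 // exprn_ge0 // ltW.
(* Both summands are at most $e^{-2n}$, and $2e^{-2n}\le e^{-n}$ since $e^n\ge1+n\ge2$. *)
apply: (@le_trans _ _ (expR (- (2 * n%:R)) + expR (- (2 * n%:R)))); last first.
  have -> : - (2 * n%:R) = - n%:R + - n%:R :> R by ring.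
  rewrite expRD -mulrDl ler_piMl ?expR_ge0 // -mulr2n -[_ *+ 2]mulr_natr expRN mulrC.
  rewrite ler_pdivrMr ?expR_gt0 // mul1r (le_trans _ (expR_ge1Dx _)) //.
  by rewrite -[2]natr1 addrC lerD2l ler1n.
apply: lerD T1 _.
apply: (@le_trans _ _ (expR (- (L / 8)) ^+ r)).
  apply: lerXn2r; rewrite ?nnegrE ?expR_ge0 //; first exact: mulr_ge0 (expR_ge0 _).
  apply: (@le_trans _ _ (expR (D * L + 1 / 16 * L) * expR (L / 16 - 9 / 8 * D * L))).
    by apply: ler_pM; rewrite ?expR_ge0 ?ler_expR.
  (* The exponent sums to [L / 8 - D * L / 8], which is at most [- (L / 8)] because [D >= 2], that
     is [C >= 4]. *)
  by rewrite -expRD ler_expR; have := ler_wpM2r (ltW L0) D2; clear; lra.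
rewrite -expRM_natl ler_expR; have := ler_wpM2r (ltW L0) mr; clear -mL; lra.
Qed.

Theorem theorem1p3 (R : realType) (p : R) (C : nat) :
  0 < p < 1 -> (4 <= C)%N ->
  exists eps : nat -> R,
    eps n @[n --> \oo] --> (0 : R) /\
    \forall n \near \oo,
      let k := (k0 p n - C)%N in
      Gnp_prob p
        (@has_edge_disjoint_cliques R n k
           (5 * (C%:R - 2) / (1 - p) *
            (p * n%:R ^+ 2 * ln n%:R / k%:R ^+ 4)))
      <= expR (- (n%:R `^ (1 + eps n))).
Proof.
(* The bound obtained is $e^{-n}$ itself, so the error term in the exponent can be 0. *)
move=> hp C4; exists (fun=> 0); split; first exact: cvg_cst.
pose b := - ln p; pose c : R := 5 * (C%:R - 2) * p / (1 - p).
(* These thresholds for [ln n] turn the three remaining growth hypotheses into lower bounds on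
   [ln n]. *)
have [M2 F2] := @pow_le_expR R ((6 / (b * p ^+ 2)) ^+ C * expR 1 * (3 / b) ^+ 4 / c)
  (1 / 16) (C + 3) ltac:(lra).
have [M3 F3] := @pow_le_expR R (1296 / (c * b ^+ 4)) 1 2 ltr01.
have [M4 F4] := @pow_le_expR R (8 * (3 / b) ^+ 6) 1 6 ltr01.
near=> n => /=.
rewrite addr0 powRr1 //.
have -> : 5 * (C%:R - 2) / (1 - p) * (p * n%:R ^+ 2 * ln n%:R / (k0 p n - C)%:R ^+ 4) =
    c * (n%:R ^+ 2 * ln n%:R / (k0 p n - C)%:R ^+ 4) by rewrite /c; ring.
apply: Gnp_prob_cliques_le_expRN => //; rewrite -/b -/c; try by near: n; exact: ln_near_infty.
- by near: n; exact: nbhs_infty_ge.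
- by apply: F2; near: n; exact: ln_near_infty.
- by apply: F3; near: n; exact: ln_near_infty.
- by apply: F4; near: n; exact: ln_near_infty.
Unshelve. all: by end_near.
Qed.
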